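(* One has $f(3,4)\ge39$; that is, there exists a family of $39$ distinct $3$-element sets containing no $4$-sunflower.
   Context: $f(w,k)$ denotes the maximum size of a finite family of distinct $w$-element sets (on an arbitrary finite ground set) containing no $k$-sunflower. A $k$-sunflower is a collection of $k$ distinct sets $A_1,\dots,A_k$ for which there is a set $C$ (the core, possibly empty) with $A_i\cap A_j=C$ for all $i\ne j$. *)

(* Defs.v *)
(* classical_sets comes first so that finset's names and notations win. *)
From mathcomp Require Import boolp classical_sets.
From mathcomp Require Import all_boot.

Set Implicit Arguments.
Unset Strict Implicit.
Unset Printing Implicit Defensive.

Definition is_sunflower (T : finType) (k : nat) (S : {set {set T}}) : Prop :=
  #|S| = k /\
  exists C : {set T}, forall A B, A \in S -> B \in S -> A != B -> A :&: B = C.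

Definition sunflower_free (T : finType) (k : nat) (F : {set {set T}}) : Prop :=
  forall S : {set {set T}}, S \subset F -> ~ is_sunflower k S.

Definition uniform (T : finType) (w : nat) (F : {set {set T}}) : Prop :=
  forall A, A \in F -> #|A| = w.

Definition attained (w k m : nat) : Prop :=
  exists (T : finType) (F : {set {set T}}),
    [/\ #|F| = m, uniform w F & sunflower_free k F].

Definition is_max_attained (w k m : nat) : Prop :=
  attained w k m /\ forall m', attained w k m' -> m' <= m.

(* The default value 0 is only taken when k = 0 (see [fP]): the empty
   collection is a 0-sunflower, so no family is free of 0-sunflowers. *)
Definition f (w k : nat) : nat := xget 0 [set m | is_max_attained w k m]%classic.

(* Erdős-Rado bound, needed for the maximum to exist. *)
Lemma sunflower_bound (T : finType) (k w : nat) (F : {set {set T}}) :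
  0 < k -> uniform w F -> sunflower_free k F -> #|F| <= w`! * k.-1 ^ w.
Proof.
move=> k0; elim: w F => [|w IHw] F Fw Fk.
  have [->|[A AF]] := set_0Vmem F; first by rewrite cards0.
  rewrite fact0 expn0 muln1.
  apply: (@leq_trans #|[set (@set0 T)]|); last by rewrite cards1.
  apply: subset_leq_card; apply/subsetP => B /Fw /eqP.
  by rewrite cards_eq0 inE.
pose P (S : {set {set T}}) := (S \subset F) && trivIset S.
have P0 : P set0 by rewrite /P sub0set; apply/trivIsetP => A B; rewrite inE.
have [S /maxsetP[/andP[SF Striv] Smax] _] := maxset_exists P0.
have Sk : #|S| <= k.-1.
  rewrite -ltnS prednK // ltnNge; apply/negP => kS.
  have [B sBS cB] : exists2 B : {set {set T}}, B \subset S & #|B| = k.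
    have : 0 < #|[set B : {set {set T}} | B \subset S & #|B| == k]|.
      by rewrite cards_draws bin_gt0.
    by case/card_gt0P => B; rewrite inE => /andP[BS /eqP cB]; exists B.
  apply: (Fk B (subset_trans sBS SF)); split => //; exists set0 => X Y XB YB XY.
  apply/eqP; rewrite setI_eq0.
  by apply: (trivIsetP Striv) => //; apply: (subsetP sBS).
pose U := cover S.
have cU : #|U| <= w.+1 * k.-1.
  apply: leq_trans (leq_card_cover S) _.
  rewrite (eq_bigr (fun=> w.+1)); last by move=> A /(subsetP SF)/Fw.
  by rewrite sum_nat_const mulnC leq_mul2l Sk orbT.
have meet A : A \in F -> exists2 x, x \in U & x \in A.
  move=> AF; have [dAU|] := boolP [disjoint A & U]; last first.
    by case/pred0Pn => x /andP[xA xU]; exists x.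
  have AS : A \in S.
    rewrite -(Smax (A |: S)) ?setU11 ?subsetUr //.
    rewrite /P subUset sub1set AF SF /=; apply/trivIsetP => X Y.
    have dA Z : Z \in S -> [disjoint A & Z].
      move=> ZS; apply: disjointWr dAU; exact: bigcup_sup.
    rewrite !inE => /orP[/eqP->|XS] /orP[/eqP->|YS]; rewrite ?eqxx // => XY.
    - exact: dA.
    - by rewrite disjoint_sym; apply: dA.
    - exact: (trivIsetP Striv).
  have : 0 < #|A| by rewrite Fw.
  case/card_gt0P => x xA; exists x => //; apply/bigcupP; by exists A.
pose link x := [set A in F | x \in A].
have clink x : #|link x| <= w`! * k.-1 ^ w.
  have inj : {in link x &, injective (fun A : {set T} => A :\ x)}.
    move=> A B; rewrite !inE => /andP[_ xA] /andP[_ xB] e.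
    by rewrite -(setD1K xA) e setD1K.
  rewrite -(card_in_imset inj); apply: IHw.
    move=> _ /imsetP[A + ->]; rewrite inE => /andP[/Fw cA xA].
    by move: cA; rewrite (cardsD1 x) xA => -[].
  move=> R RL [cR [C hC]].
  have xR A : A \in R -> (x \notin A) * (x |: A \in F).
    move=> /(subsetP RL)/imsetP[B + ->]; rewrite inE => /andP[BF xB].
    by rewrite setD1K // !inE eqxx.
  have injR : {in R &, injective (fun A : {set T} => x |: A)}.
    by move=> A B /xR[xA _] /xR[xB _] e; rewrite -(setU1K xA) e setU1K.
  apply: (Fk [set x |: A | A in R]).
    by apply/subsetP => _ /imsetP[A /xR[_ ?] ->].
  split; first by rewrite card_in_imset.
  exists (x |: C) => _ _ /imsetP[A AR ->] /imsetP[B BR ->] AB.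
  rewrite -setUIr hC //; by apply: contraNneq AB => ->.
have sFU : F \subset \bigcup_(x in U) link x.
  apply/subsetP => A AF; have [x xU xA] := meet A AF.
  by apply/bigcupP; exists x => //; rewrite inE AF.
apply: leq_trans (subset_leq_card sFU) _.
apply: (@leq_trans (\sum_(x in U) #|link x|)).
  elim/big_rec2: _ => [|x m A _ h]; first by rewrite cards0.
  by apply: leq_trans (leq_card_setU _ _) _; rewrite leq_add2l.
apply: leq_trans (leq_sum _ (fun x _ => clink x)) _.
rewrite sum_nat_const factS expnS mulnACA leq_mul2r cU orbT //.
Qed.

Lemma fP (w k : nat) : 0 < k -> is_max_attained w k (f w k).
Proof.
move=> k0.
have a0 : exists m, `[< attained w k m >].
  exists 0; apply/asboolP; exists unit, set0; rewrite cards0; split => //.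
    by move=> A; rewrite inE.
  move=> S; rewrite subset0 => /eqP-> [e _].
  by move: k0; rewrite -e cards0.
have ub m : `[< attained w k m >] -> m <= w`! * k.-1 ^ w.
  by move=> /asboolP[T [F [<- Fw Fk]]]; apply: sunflower_bound.
have [m /asboolP am mmax] := ex_maxnP a0 ub.
apply: (@xgetPex _ 0 [set m | is_max_attained w k m]%classic).
by exists m; split => // m' am'; apply: mmax; apply/asboolP.
Qed.

(* Main.v *)
Require Import Defs.
From mathcomp Require Import all_boot.

(* The ground set has 13 points: three groups G_0, G_1, G_2 of three points
   each, three points p_0, p_1, p_2, and a point oo. The 39 triples are
   - the three groups,
   - the nine {x, y, oo} with x, y in the same group,
   - the 27 {x, y, p_k} with x in G_i, y in G_j and {i, j, k} = {0, 1, 2}.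
   The link of p_k is K_{3,3}, the link of oo is three triangles, and the link
   of a point of a group is two 3-stars and a triangle; all have matching number
   3 and maximum degree at most 3, so no 4-sunflower has a core of size 1 or 2.
   There are no four disjoint triples either. At most one of them contains oo.
   A triple through p_k meets two groups, so it leaves room for at most one
   group, and two such triples meet all three groups; three of them leave only
   one point in each group, excluding the triples through oo too. *)

(* Points: G_i = {3i, 3i+1, 3i+2}, p_k = 9+k and oo = 12. *)
Definition is_block (s : seq nat) : bool :=
  if s is [:: x; y; z] then
    (x < y < z) &&
    (if z < 9 then x %/ 3 == z %/ 3
     else if z == 12 then (y < 9) && (x %/ 3 == y %/ 3)
     else [&& y < 9, x %/ 3 != y %/ 3 & x %/ 3 + y %/ 3 + (z - 9) == 3])
  else false.

Definition blocks : seq (seq nat) :=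
  [seq s <- [seq x :: s | x <- iota 0 13,
                          s <- [seq [:: y; z] | y <- iota 0 13, z <- iota 0 13]]
         | is_block s].

Definition meet (s t : seq nat) : seq nat :=
  [seq i <- iota 0 13 | (i \in s) && (i \in t)].

Definition has_core (c : seq nat) (p : seq (seq nat)) : bool :=
  pairwise (fun s t => meet s t == c) p.

(** Two members fix the core; with fewer, any core will do. *)
Definition sunflower_seq (p : seq (seq nat)) : bool :=
  has_core (if p is [:: s, t & _] then meet s t else [::]) p.

(* [extendable n p r]: some n members of r, prepended to p in reverse order,
   yield a sunflower; branches whose prefix is not a sunflower are cut (by [if],
   since call-by-value evaluation of [&&] would explore them). *)
Fixpoint extendable (n : nat) (p r : seq (seq nat)) : bool :=
  if n is n'.+1 then
    (fix loop r := if r is s :: r' then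
       (if sunflower_seq (s :: p) then extendable n' (s :: p) r' else false)
       || loop r'
     else false) r
  else true.

Lemma has_core_sunflower_seq c p : has_core c p -> sunflower_seq p.
Proof.
by case: p => [|s [|t p]] // h; case/andP: (h) => /andP[/eqP st _] _; rewrite /sunflower_seq st.
Qed.

(** No cut loses a sunflower: each partial list is a suffix of [catrev t p], so it also has core
    [c]. *)
Lemma extendable_subseq c t r p :
  subseq t r -> has_core c (catrev t p) -> extendable (size t) p r.
Proof.
elim: t r p => [|s t IHt] r p //=; elim: r => // s' r IHr /=.
case: eqP => [<- tr h|_ str h]; last by rewrite [X in _ || X]IHr ?orbT.
rewrite IHt // (@has_core_sunflower_seq c) //.
by move: h; rewrite catrevE /has_core pairwise_cat => /and3P[].
Qed.

Lemma blocks_not_extendable : ~~ extendable 4 [::] blocks.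
Proof. by vm_compute. Qed.

Definition set_of (s : seq nat) : {set 'I_13} := [set i | val i \in s].

Lemma card_set_of s : #|set_of s| = count (mem s) (iota 0 13).
Proof.
rewrite -val_enum_ord count_map cardE enumT size_filter.
by apply: eq_count => i /=; rewrite inE.
Qed.

Lemma set_of_inj : {in blocks &, injective set_of}.
Proof.
(* Blocks are increasing lists, hence recovered from their sets. *)
have h : all (fun s : seq nat => s == [seq i <- iota 0 13 | i \in s]) blocks by vm_compute.
move=> s t /(allP h)/eqP es /(allP h)/eqP et e; rewrite es et.
apply: eq_in_filter => i; rewrite mem_iota => /= i13.
by move/setP/(_ (Ordinal i13)): e; rewrite !inE.
Qed.

Definition family : {set {set 'I_13}} := [set:: map set_of blocks].

Lemma card_family : #|family| = 39.
Proof.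
rewrite cardsE; apply: etrans (card_uniqP _) _; last by rewrite size_map.
by rewrite (map_inj_in_uniq set_of_inj).
Qed.

Lemma uniform_family : uniform 3 family.
Proof.
have h : all (fun s : seq nat => count (mem s) (iota 0 13) == 3) blocks by vm_compute.
move=> A; rewrite inE => /mapP[s sb ->].
by rewrite card_set_of; apply/eqP/(allP h).
Qed.

Lemma sunflower_free_family : sunflower_free 4 family.
Proof.
move=> S SF [cS [C hC]].
(* Filtering keeps the order of [blocks], giving a subsequence. *)
pose t := [seq s <- blocks | set_of s \in S].
have tS s : s \in t -> set_of s \in S by rewrite mem_filter => /andP[].
have tsub : subseq t blocks by apply: filter_subseq.
have tb := mem_subseq tsub.
have t_uniq : uniq t by rewrite filter_uniq.
have st : size t = 4.
  rewrite -cS -(size_map set_of).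
  have /card_uniqP <- : uniq (map set_of t).
    by rewrite map_inj_in_uniq // => x y /tb + /tb; apply: set_of_inj.
  apply: eq_card => A; apply/mapP/idP => [[s /tS ? ->] //|AS].
  have := subsetP SF A AS; rewrite inE => /mapP[s sb eA].
  by exists s => //; rewrite mem_filter -eA AS.
clearbody t; apply/negP: blocks_not_extendable; rewrite negbK -st.
(* [C] as an increasing list, the form that [meet] returns. *)
apply: (@extendable_subseq [seq i <- iota 0 13 | inord i \in C]).
  exact: tsub.
rewrite catrevE cats0 /has_core.
have t_neq : pairwise [rel x y | x != y] (rev t) by rewrite -uniq_pairwise rev_uniq.
apply: (sub_in_pairwise (P := mem t)) t_neq; last by apply/allP => s; rewrite mem_rev.
move=> s u st' ut su; apply/eqP; apply: eq_in_filter => i.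
rewrite mem_iota => /= i13.
have <- := hC _ _ (tS s st') (tS u ut) _; first by rewrite !inE /= inordK.
by apply: contraNneq su => /set_of_inj->; rewrite ?tb.
Qed.

Theorem theorem5p1 :
  39 <= f 3 4 /\
  exists (T : finType) (F : {set {set T}}),
    [/\ #|F| = 39, uniform 3 F & sunflower_free 4 F].
Proof.
have attained39 : attained 3 4 39.
  exists 'I_13, family.
  by split; [apply: card_family | apply: uniform_family | apply: sunflower_free_family].
by split=> //; apply: (fP 3 (isT : 0 < 4)).2.
Qed.
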